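(* Let $n\in\mathbb{N}$ and let $p(x)=\sum_{k=0}^{n}\alpha_{2k}x^{2k}$ be a real polynomial of degree $2n$ (so $\alpha_{2n}\neq 0$). Then there is a complex polynomial $q$ of degree $n$ such that $p=\alpha_{2n}\,q\,q_-$. Furthermore, if the polynomial $\tilde p(x)=\sum_{k=0}^{n}\alpha_{2k}x^{k}$ has no negative (real) roots, then $q$ can be chosen to be a real polynomial.
   Context: For a real or complex polynomial $q$, $q_-$ denotes the polynomial with the same principal (leading) coefficient as $q$ and with opposite roots, counted with multiplicity; that is, if $q(x)=a\prod_{i=1}^{n}(x-\lambda_i)$ with $a\ne 0$ and $\lambda_i\in\mathbb{C}$, then $q_-(x)=a\prod_{i=1}^{n}(x+\lambda_i)$. *)

(* Defs.v *)
From mathcomp Require Import all_boot all_order all_algebra.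
From mathcomp Require Import reals.
From mathcomp.real_closed Require Import complex.

Set Implicit Arguments.
Unset Strict Implicit.
Unset Printing Implicit Defensive.

Import GRing.Theory.
Local Open Scope ring_scope.

(* [closed_field_poly_normal q] provides the roots of [q] counted with
   multiplicity. *)
Definition opp_roots (F : closedFieldType) (q : {poly F}) : {poly F} :=
  lead_coef q *: \prod_(z <- sval (closed_field_poly_normal q)) ('X + z%:P).

(* [opp_roots q] does not depend on the factorization that is chosen. *)
Lemma opp_rootsE (F : closedFieldType) (a : F) (s : seq F) :
  opp_roots (a *: \prod_(z <- s) ('X - z%:P)) = a *: \prod_(z <- s) ('X + z%:P).
Proof.
rewrite /opp_roots; case: closed_field_poly_normal => r /= Er.
have lcE : lead_coef (a *: \prod_(z <- s) ('X - z%:P)) = a.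
  by rewrite lead_coefZ (monicP (monic_prod_XsubC s xpredT id)) mulr1.
rewrite lcE in Er *; have [-> | a0] := eqVneq a 0; first by rewrite !scale0r.
congr (_ *: _); apply: perm_big; rewrite perm_sym; apply: prod_XsubC_eq.
exact: (scalerI a0).
Qed.

(* A real polynomial viewed as a complex one; its roots are its complex
   roots. *)
Definition poly_complex (R : realType) (q : {poly R}) : {poly R[i]} :=
  map_poly (real_complex R) q.

(* Main.v *)
Require Import Defs.
From mathcomp Require Import all_boot all_order all_algebra.
From mathcomp Require Import reals.
From mathcomp.real_closed Require Import complex.

(** Write [ptilde] as [a * \prod_z (x - z)] over the complex numbers, where
    [a] is the leading coefficient of both [p] and [ptilde]. Since
    [p(x) = ptilde(x ^ 2)], we get [p = a * \prod_z (x ^ 2 - z)], and a square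
    root [r z] of each root [z] splits its factor as [(x - r z) * (x + r z)].
    So [q = \prod_z (x - r z)] works for any choice of the square roots
    ([prod_XsubC_comp_sqr]).

    The choice is made once and for all: [r] is the principal square root
    [sqrtc]. It commutes with conjugation away from the negative reals
    ([sqrtc_conj]), while the multiset of the roots of the real polynomial
    [ptilde] is stable under conjugation ([perm_conj_roots]). When no root is
    negative, the multiset of the [sqrtc z] is therefore stable as well, so that
    the coefficients of the very same [q] are real. *)

Set Implicit Arguments.
Unset Strict Implicit.
Unset Printing Implicit Defensive.

Import Order.TTheory GRing.Theory Num.Theory.
Local Open Scope ring_scope.
Local Open Scope complex_scope.

Lemma prod_XsubC_comp_sqr (K : comNzRingType) (r : K -> K) (s : seq K) :
  (forall z, r z ^+ 2 = z) ->
  (\prod_(z <- s) ('X - z%:P)) \Po 'X^2 =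
  \prod_(z <- s) ('X - (r z)%:P) * \prod_(z <- s) ('X + (r z)%:P).
Proof.
move=> rK; rewrite rmorph_prod -big_split; apply: eq_bigr => z _ /=.
by rewrite rmorphB /= comp_polyX comp_polyC -{1}(rK z) rmorphXn /= subr_sqr.
Qed.

(** The branch cut of [sqrtc] is the negative real axis: a nonzero imaginary
    part gives its sign to that of the root, and on the nonnegative reals the
    root is real. *)
Lemma sqrtc_conj (R : rcfType) (z : R[i]) :
  ~~ (z < 0) -> sqrtc z^* = (sqrtc z)^*.
Proof.
case: z => a b; rewrite ltcE /= => nlt0.
rewrite sqrrN oppr_eq0; congr (_ +i* _); have [b0 | b_neq0] := eqVneq b 0.
  move: nlt0; rewrite b0 eqxx /= -leNgt => a_ge0.
  by rewrite expr0n addr0 sqrtr_sqr ger0_norm // subrr mul0r sqrtr0 mulr0 oppr0.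
by rewrite sgrN mulNr.
Qed.

Lemma poly_complex_conj (R : realType) (p : {poly R}) :
  map_poly conjc (poly_complex p) = poly_complex p.
Proof.
by apply/polyP => i; rewrite /poly_complex !coef_map /= oppr0.
Qed.

Lemma conj_poly_real (R : realType) (q : {poly R[i]}) :
  map_poly conjc q = q -> q = poly_complex (map_poly (@complex.Re R) q).
Proof.
move=> qJ; apply/polyP => i; rewrite coef_map /= coef_map_id0 //.
have := congr1 (fun r : {poly _} => r`_i) qJ; rewrite coef_map /=.
case: (q`_i) => a b [/eqP]; rewrite eq_sym -addr_eq0 -mulr2n mulrn_eq0 /=.
by move=> /eqP ->.
Qed.

Lemma perm_conj_roots (R : realType) (p : {poly R}) (a : R) (s : seq R[i]) :
  a != 0 -> poly_complex p = a%:C *: \prod_(z <- s) ('X - z%:P) ->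
  perm_eq [seq z^* | z <- s] s.
Proof.
move=> a0 Ep; apply: prod_XsubC_eq; rewrite big_map.
have aC0 : a%:C != 0 by rewrite fmorph_eq0.
apply: (scalerI aC0); rewrite -Ep -poly_complex_conj Ep map_polyZ /= oppr0.
by rewrite map_prod_XsubC.
Qed.

Theorem lemma3p1 (R : realType) (n : nat) (alpha : nat -> R) (p ptilde : {poly R})
  (p_def : p = \sum_(k < n.+1) alpha (2 * k)%N *: 'X^(2 * k))
  (ptilde_def : ptilde = \sum_(k < n.+1) alpha (2 * k)%N *: 'X^k)
  (p_deg : size p = (2 * n).+1) :
  (exists q : {poly R[i]},
     size q = n.+1 /\
     poly_complex p = (alpha (2 * n)%N)%:C *: (q * opp_roots q)) /\
  ((forall x : R, x < 0 -> ~~ root ptilde x) ->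
   exists q : {poly R},
     size q = n.+1 /\
     poly_complex p =
       (alpha (2 * n)%N)%:C *: (poly_complex q * opp_roots (poly_complex q))).
Proof.
have p_comp : p = ptilde \Po 'X^2.
  rewrite p_def ptilde_def linear_sum; apply: eq_bigr => k _ /=.
  by rewrite comp_polyZ rmorphXn /= comp_polyX exprM.
have ptilde_neq0 : ptilde != 0.
  by apply/eqP => pt0; move: p_deg; rewrite p_comp pt0 comp_poly0 size_poly0.
have ptilde_size : size ptilde = n.+1.
  have := size_comp_poly ptilde 'X^2; rewrite -p_comp p_deg size_polyXn /=.
  rewrite mulnC => /eqP; rewrite eqn_pmul2r // => /eqP ->.
  by rewrite prednK // size_poly_gt0.
have ptilde_lead : lead_coef ptilde = alpha (2 * n)%N.
  by rewrite lead_coefE ptilde_size ptilde_def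
    -(poly_def _ (fun k => alpha (2 * k)%N)) coef_poly ltnSn.
have a_neq0 : alpha (2 * n)%N != 0 by rewrite -ptilde_lead lead_coef_eq0.
have [s Es] := closed_field_poly_normal (poly_complex ptilde).
rewrite lead_coef_map ptilde_lead /= in Es.
have s_size : size s = n.
  apply: succn_inj; rewrite -ptilde_size -(size_map_poly (real_complex R)).
  by rewrite -/(poly_complex _) Es size_scale ?fmorph_eq0 // size_prod_XsubC.
pose q := \prod_(z <- s) ('X - (sqrtc z)%:P).
have q_size : size q = n.+1 by rewrite size_prod_XsubC s_size.
have q_fact : poly_complex p = (alpha (2 * n)%N)%:C *: (q * opp_roots q).
  rewrite p_comp /poly_complex map_comp_poly map_polyXn -/(poly_complex _) Es.
  rewrite comp_polyZ (prod_XsubC_comp_sqr _ (@sqr_sqrtc R)) -/q.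
  have := opp_rootsE 1 [seq sqrtc z | z <- s].
  by rewrite !scale1r !big_map => <-.
split=> [|no_neg_root]; first by exists q.
have q_real : q = poly_complex (map_poly (@complex.Re R) q).
  apply: conj_poly_real.
  rewrite /q map_prod_XsubC -[RHS](perm_big _ (perm_conj_roots a_neq0 Es)) /=.
  rewrite big_map; apply: eq_big_seq => z zs; rewrite sqrtc_conj //.
  apply/negP => z_lt0; have /eqP Imz : complex.Im z == 0.
    by move: z_lt0; rewrite ltcE eq_sym => /andP[].
  have z_re : z = (complex.Re z)%:C by case: z Imz {zs z_lt0} => x y /= ->.
  have /negP[] : ~~ root ptilde (complex.Re z).
    by apply: no_neg_root; rewrite -ltcR -z_re.
  rewrite -(fmorph_root (real_complex R)) /= -z_re -/(poly_complex _) Es.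
  by rewrite rootZ ?fmorph_eq0 // root_prod_XsubC.
exists (map_poly (@complex.Re R) q); rewrite -q_real; split=> //.
by rewrite -q_size {2}q_real size_map_poly.
Qed.
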